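(* Let $\alpha\in\mathbb{T}$ be irrational and badly approximable (i.e. its continued fraction partial quotients are bounded), and let $t\in\mathbb{T}$. Then the group $E^2(a,t)$ of essential values of the cocycle $(a,t)$ equals $G=\{(s_1,s_2)\in\mathbb{Z}^2\mid s_1\equiv s_2 \bmod 2\}$ if and only if $t\notin \mathbb{Z}\alpha$ and $t\notin\mathbb{Z}\alpha+\tfrac12$ (modulo 1).
   Context: $\mathbb{T}=[0,1)=\mathbb{R}/\mathbb{Z}$ with Lebesgue measure $\mu$, $T_0x=x+\alpha\bmod 1$. Let $f(x)=1$ for $0\le x<\tfrac12$, $f(x)=-1$ for $\tfrac12\le x<1$. For $n\ge1$, $a_n(x)=\sum_{i=0}^{n-1}f(x+i\alpha)$; $a_0=0$; $a_n(x)=-a_{-n}(T_0^{n}x)$ for $n\le-1$. The cocycle $(a,t)$ is $(n,x)\mapsto(a_n(x),a_n(x+t))\in\mathbb{Z}^2$. A pair $(k_1,k_2)\in\mathbb{Z}^2$ is an essential value of $(a,t)$ if for every measurable $A\subset\mathbb{T}$ with $\mu(A)>0$, $\mu\big(\bigcup_{n\in\mathbb{Z}}(A\cap T_0^{-n}A\cap\{x:a_n(x)=k_1\}\cap\{x:a_n(x+t)=k_2\})\big)>0$; $E^2(a,t)$ is the set of such pairs. *)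

(* Defs.v *)
From mathcomp Require Import all_boot all_order all_algebra.
From mathcomp Require Import all_classical all_reals all_analysis.

Set Implicit Arguments.
Unset Strict Implicit.
Unset Printing Implicit Defensive.

Import Order.TTheory GRing.Theory Num.Theory.
Import numFieldNormedType.Exports.

Local Open Scope classical_set_scope.
Local Open Scope ring_scope.

(* The circle R/Z is represented by the interval [0, 1[ with
   the restriction of Lebesgue measure; points are reduced modulo 1 by the
   fractional part. *)

Definition frac_part (R : realType) (x : R) : R := x - (Num.floor x)%:~R.

Definition eq_mod1 (R : realType) (x y : R) : Prop :=
  exists m : int, x - y = m%:~R.

(* The [n]-th iterate, for [n] of either sign, of the rotation by [alpha]; the
   iterates of [x |-> x + alpha mod 1] have this closed form on [0, 1[. *)
Definition rotation (R : realType) (alpha : R) (n : int) (x : R) : R :=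
  frac_part (x + n%:~R * alpha).

(* Defined on all of R as a 1-periodic function, so that [step_fun (x + y)]
   needs no further reduction modulo 1. *)
Definition step_fun (R : realType) (x : R) : int :=
  if frac_part x < 2^-1 then 1 else -1.

Definition birkhoff_sum (R : realType) (alpha : R) (n : nat) (x : R) : int :=
  \sum_(i < n) step_fun (x + i%:R * alpha).

(* [Negz m] is the integer [- m.+1]. *)
Definition cocycle (R : realType) (alpha : R) (n : int) (x : R) : int :=
  match n with
  | Posz m => birkhoff_sum alpha m x
  | Negz m => - birkhoff_sum alpha m.+1 (rotation alpha n x)
  end.

(* [measurable] is Borel measurability; since every Lebesgue measurable set
   contains a Borel set of the same measure, quantifying over Lebesgue
   measurable sets gives the same essential values. As [A] lies in [0, 1[, the
   preimage of [A] under the [n]-th iterate is only used there. *)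
Definition essential_value (R : realType) (alpha t : R) (k : int * int) : Prop :=
  forall A : set R, measurable A -> A `<=` `[0, 1[ ->
    (0 < lebesgue_measure A)%E ->
    (0 < lebesgue_measure
           (\bigcup_(n in [set: int])
              (A `&` rotation alpha n @^-1` A
                 `&` [set x | cocycle alpha n x = k.1]
                 `&` [set x | cocycle alpha n (x + t)%R = k.2])))%E.

Definition essential_values (R : realType) (alpha t : R) : set (int * int) :=
  [set k | essential_value alpha t k].

Definition same_parity : set (int * int) :=
  [set s | (s.1 = s.2 %[mod 2])%Z].

(* For irrational [x] no fractional part below vanishes, so the convention
   [0^-1 = 0] plays no role. *)
Fixpoint complete_quotient (R : realType) (x : R) (n : nat) : R :=
  if n is n'.+1 then (frac_part (complete_quotient x n'))^-1 else x.

Definition partial_quotient (R : realType) (x : R) (n : nat) : int :=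
  Num.floor (complete_quotient x n).

Definition badly_approximable (R : realType) (x : R) : Prop :=
  irrational x /\ exists M : int, forall n : nat, partial_quotient x n <= M.

(* Main.v *)
(* The pair of sums (a_n(x), a_n(x + t)) always has two entries of the parity of
   n. If t = k alpha, or t = k alpha + 1/2, then a_n(x + t) - a_n(x), or
   a_n(x + t) + a_n(x), is bounded by 2|k|, so (0, m) is not essential for m
   large.

   Conversely, by Lebesgue density it is enough to look at scale 1/N around a
   density point of A. For q <= N with ||q alpha|| < 1/N, bad approximability
   keeps the jumps of a_q at mutual distance >> 1/N, so a_q is bounded
   uniformly, and there is a jump of a_q within O(1/N) of every point. The jumps
   of a_q(. + t) are also at distance >> 1/N from those of a_q for infinitely
   many N: otherwise t is so close to some k_N alpha (mod 1/2), |k_N| <= N, that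
   k_N = k_(N+1) for all large N. At such scales A returns to itself at
   time q with two pairs v and v + (2, 0), where v ranges over a finite
   set; ergodicity makes v independent of A, and (2, 0) is an essential value.
   By symmetry so is (0, 2), and an odd return time of A then gives the
   remaining classes modulo 2. *)

Require Import Defs.
From mathcomp Require Import all_boot all_order all_algebra.
From mathcomp Require Import all_classical all_reals all_analysis.
From mathcomp Require Import measurable_realfun zify ring lra.

Set Implicit Arguments.
Unset Strict Implicit.
Unset Printing Implicit Defensive.

Import Order.TTheory GRing.Theory Num.Theory.
Import numFieldNormedType.Exports.

Local Open Scope classical_set_scope.
Local Open Scope ring_scope.

(** * Badly approximable numbers *)


Lemma frac_part_ge0 (R : realType) (x : R) : 0 <= frac_part x.
Proof. by rewrite /frac_part subr_ge0 floor_le. Qed.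

Lemma frac_part_lt1 (R : realType) (x : R) : frac_part x < 1.
Proof. by rewrite /frac_part ltrBlDr addrC -intrD1 floorD1_gt. Qed.

(** The fixpoint unfolds at its last step; the descent below needs the shift at the first one. *)
Lemma complete_quotientSr (R : realType) (x : R) n :
  complete_quotient (frac_part x)^-1 n = complete_quotient x n.+1.
Proof. by elim: n => //= n ->. Qed.

Lemma irrational_frac_gt0 (R : realType) (x : R) :
  irrational x -> 0 < frac_part x.
Proof.
move=> ix; rewrite lt_neqAle frac_part_ge0 andbT eq_sym subr_eq0.
by apply/eqP => xE; apply: ix; exists (Num.floor x)%:~R => //; rewrite ratr_int -xE.
Qed.

Lemma irrational_fracV (R : realType) (x : R) :
  irrational x -> irrational (frac_part x)^-1.
Proof.
move=> ix [q _ qE]; apply: ix; exists (q^-1 + (Num.floor x)%:~R) => //.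
by rewrite rmorphD fmorphV/= qE invrK ratr_int /frac_part subrK.
Qed.

(* [|k x - p| (p + k w) / (x + w)], with [- w] in the role of a conjugate of
   [x], is invariant under the Gauss map
   [x = n + 1/y], [w' = 1/(n + w)], [(k, p) |-> (p - n k, k)]. *)
Lemma gauss_descent (R : realType) (M : int) (B := (M + 1)%:~R : R) (m : nat)
    (x w : R) (k p : nat) :
  irrational x -> (forall n, partial_quotient x n <= M) -> 1 < x ->
  B^-1 <= w <= 1 -> (k + p <= m)%N -> (0 < k + p)%N ->
  (B * (B + 1))^-1 * (x + w) <= `|k%:R * x - p%:R| * (p%:R + k%:R * w).
Proof.
elim: m x w k p => [|m IH] x w k p ix xM x1 /andP[wB w1] kpm kp0; first lia.
have fx : (1 <= Num.floor x) by rewrite -[1]/(1%:Z) floor_ge_int ltW.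
have fM : Num.floor x <= M := xM 0%N.
case nE: (Num.floor x) (floorD1_gt x) (floor_le x) fx fM => [n|//] xn nx n1 nM.
have nB : n%:R + 1 <= B :> R by rewrite /B -[n%:R]/(n%:~R) -intrD1 ler_int lerD2r.
have B1 : 2 <= B by apply: le_trans nB; rewrite -[2]/(1 + 1) lerD2r (ler_nat _ 1%N).
have B0 : 0 < B by lra.
have w0 : 0 < w by apply: lt_le_trans wB; rewrite invr_gt0.
have xB : x < B by apply: lt_le_trans nB; rewrite intrD1 in xn.
set c := (B * (B + 1))^-1.
have c0 : 0 < c by rewrite invr_gt0 mulr_gt0//; lra.
have cB : c * (x + w) <= B^-1.
  rewrite /c invfM -mulrA ger_pMr ?invr_gt0// ler_pdivrMl; lra.
have VB1 : B^-1 <= 1 by rewrite invf_le1//; lra.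
case: k => [|k] in kpm kp0 *.
  rewrite !mul0r addr0 sub0r normrN normr_nat.
  apply: (le_trans cB); apply: (le_trans VB1).
  by rewrite -natrM (ler_nat _ 1%N) muln_gt0 andbb -[p]add0n.
have k1 : 1 <= k.+1%:R :> R by rewrite (ler_nat _ 1%N).
(* If [p < n * k.+1], the first factor is at least 1 and the second at least [w >= B^-1]. Otherwise
   [p - n * k.+1] is a natural number and the pair passes to the next complete quotient with a
   smaller sum. *)
have [pnk|pnk] := ltnP p (n * k.+1).
  apply: (le_trans cB).
  have h1 : p%:R + 1 <= n%:R * k.+1%:R :> R.
    by rewrite -natrM -(natrD _ p 1) ler_nat addn1.
  have h2 : n%:R * k.+1%:R <= x * k.+1%:R by rewrite ler_wpM2r//; lra.
  have h3 : 1 <= `|k.+1%:R * x - p%:R|.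
    by apply: le_trans (ler_norm _); rewrite [k.+1%:R * x]mulrC; lra.
  have h4 : B^-1 <= p%:R + k.+1%:R * w.
    have : 0 <= p%:R :> R by [].
    have : w <= k.+1%:R * w by rewrite ler_peMl// ltW.
    lra.
  by rewrite -[B^-1]mul1r ler_pM// invr_ge0 ltW.
have e0 := irrational_frac_gt0 ix.
have e1 := frac_part_lt1 x.
have eE : frac_part x = x - n%:R by rewrite /frac_part nE.
set e := frac_part x in e0 e1 eE.
have nw0 : 0 < w + n%:R by rewrite ltr_pwDl.
have k1n : (k.+1 <= n * k.+1)%N by apply: leq_pmull; clear -n1; lia.
have {IH} : c * (e^-1 + (w + n%:R)^-1) <=
  `|(p - n * k.+1)%:R * e^-1 - k.+1%:R|
    * (k.+1%:R + (p - n * k.+1)%:R * (w + n%:R)^-1).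
  apply: (IH e^-1 (w + n%:R)^-1 (p - n * k.+1)%N k.+1).
  - exact: irrational_fracV.
  - by move=> i; rewrite /partial_quotient complete_quotientSr; exact: xM.
  - by rewrite invf_gt1.
  - rewrite lef_pV2 ?posrE//; apply/andP; split; first lra.
    rewrite invf_le1//; have : 1 <= n%:R :> R by rewrite (ler_nat _ 1%N).
    lra.
  - by clear -k1n pnk kpm; lia.
  - by rewrite addnS.
(* Both sides of the induction hypothesis are those of the goal times [e^-1 / (w + n)]. *)
rewrite natrB// natrM.
have -> : (p%:R - n%:R * k.+1%:R) * e^-1 - k.+1%:R = - (k.+1%:R * x - p%:R) / e.
  by rewrite -(subrK n%:R x) -eE; field; rewrite gt_eqF.
rewrite normrM normrN normfV (gtr0_norm e0).
have -> : k.+1%:R + (p%:R - n%:R * k.+1%:R) / (w + n%:R) =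
   (p%:R + k.+1%:R * w) / (w + n%:R) by field; rewrite gt_eqF.
have -> : e^-1 + (w + n%:R)^-1 = (x + w) * (e^-1 / (w + n%:R)).
  by rewrite -(subrK n%:R x) -eE; field; rewrite !gt_eqF.
rewrite [leRHS]mulrACA [leLHS]mulrA.
by rewrite ler_pM2r// divr_gt0// invr_gt0.
Qed.

(** [gauss_descent] applies to [alpha^-1], the first complete quotient, with [w = 1] and the roles
    of [k] and [p] exchanged. For [0 <= p <= k] the factor [k + p] is at most [2 k]; for other [p]
    the distance is at least 1. *)
Lemma badly_approximable_lb (R : realType) (alpha : R) :
  0 <= alpha < 1 -> badly_approximable alpha ->
  exists2 c : R, 0 < c & forall k p : int, k != 0 ->
    c <= `|k%:~R| * `|k%:~R * alpha - p%:~R|.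
Proof.
move=> /andP[a0 a1] [ia [M aM]].
have fa : frac_part alpha = alpha.
  rewrite /frac_part (_ : Num.floor alpha = 0) ?subr0//.
  by apply: floor_def; rewrite a0 add0r.
have {}a0 : 0 < alpha by rewrite -fa irrational_frac_gt0.
have yM n : partial_quotient alpha^-1 n <= M.
  by rewrite -{1}fa /partial_quotient complete_quotientSr; exact: aM.
have M1 : 1 <= M.
  apply: le_trans (yM 0%N); rewrite /partial_quotient/= -[1]/(1%:Z) floor_ge_int.
  by rewrite invf_ge1// ltW.
set B : R := (M + 1)%:~R.
have B2 : 2 <= B by rewrite /B -[2]/(2%:~R) ler_int; lia.
set c := (B * (B + 1))^-1.
have c0 : 0 < c by rewrite invr_gt0 mulr_gt0//; lra.
have c1 : c <= 1.
  rewrite invf_le1 ?mulr_gt0//; try lra.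
  nra.
have main (k : nat) (p : int) : (0 < k)%N ->
    c / 2 <= k%:R * `|k%:R * alpha - p%:~R|.
  move=> k0; have k1 : 1 <= k%:R :> R by rewrite (ler_nat _ 1%N).
  have far : 1 <= `|k%:R * alpha - p%:~R| ->
     c / 2 <= k%:R * `|k%:R * alpha - p%:~R|.
    move=> h; have : 1 * 1 <= k%:R * `|k%:R * alpha - p%:~R| by rewrite ler_pM.
    lra.
  have [p0|p0] := ltP p 0.
    apply: far; apply: le_trans (ler_norm _).
    have : p%:~R <= -1 :> R by rewrite -[-1]/((-1)%:~R) ler_int; lia.
    have : 0 <= k%:R * alpha by rewrite mulr_ge0// ltW.
    lra.
  case: p p0 far => // p _ far; rewrite -[p%:~R]/(p%:R) in far *.
  have [pk|pk] := ltnP k p.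
    apply: far; rewrite distrC; apply: le_trans (ler_norm _).
    have : k%:R + 1 <= p%:R :> R by rewrite -(natrD _ k 1) ler_nat addn1.
    have : k%:R * alpha <= k%:R by rewrite ler_piMr// ltW.
    lra.
  have : c * (alpha^-1 + 1) <= `|p%:R / alpha - k%:R| * (k%:R + p%:R * 1).
    apply: (@gauss_descent R M (p + k) alpha^-1 1 p k) => //.
    - by rewrite -fa; exact: irrational_fracV.
    - by rewrite invf_gt1.
    - by rewrite lexx andbT invf_le1; lra.
    - by clear -k0; lia.
  rewrite mulr1.
  have -> : p%:R / alpha - k%:R = - (k%:R * alpha - p%:R) / alpha.
    by field; rewrite gt_eqF.
  have -> : alpha^-1 + 1 = (1 + alpha) / alpha by field; rewrite gt_eqF.
  rewrite normrM normrN normfV (gtr0_norm a0) mulrA [leRHS]mulrAC ler_pM2r ?invr_gt0//.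
  have pk' : p%:R <= k%:R :> R by rewrite ler_nat.
  have := normr_ge0 (k%:R * alpha - p%:R); set d := `|_|.
  have : c <= c * (1 + alpha) by rewrite ler_peMr//; lra.
  have : d * (k%:R + p%:R) <= d * (k%:R + k%:R).
    by apply: ler_wpM2l; [exact: normr_ge0|rewrite lerD2l].
  clear -c0; lra.
exists (c / 2); first by rewrite divr_gt0.
move=> [k|k] p k0; first by rewrite -[k%:~R]/(k%:R) normr_nat; apply: main; lia.
have := main k.+1 (- p) isT.
by rewrite NegzE !mulrNz opprK normrN normr_nat mulNr -opprD normrN.
Qed.


(** Pigeonhole: the [N + 1] fractional parts of [i alpha], [i <= N], fall into [N] intervals of
    length [1 / N]; [q] is the difference of two indices that share one. *)
Lemma dirichlet_approx (R : realType) (alpha : R) (N : nat) : (0 < N)%N ->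
  exists q : nat, exists p : int,
    (0 < q <= N)%N /\ `|q%:R * alpha - p%:~R| < N%:R^-1.
Proof.
case: N => // N _; set n := N.+1; have n0 : 0 < n%:R :> R by [].
pose f i := frac_part (i%:R * alpha).
have f0 i : 0 <= n%:R * f i by rewrite mulr_ge0// frac_part_ge0.
pose h (i : 'I_n.+1) : 'I_n := inord (Num.truncn (n%:R * f i)).
have hE (i : 'I_n.+1) : Num.truncn (n%:R * f i) = h i.
  by rewrite inordK// truncn_lt_nat// gtr_pMr// frac_part_lt1.
have /injectivePn[x [y xy hxy]] : ~~ injectiveb h.
  by apply/injectiveP => /leq_card; rewrite !card_ord ltnn.
wlog xlty : x y xy hxy / (x < y)%N.
  move=> W; have [|yx|/val_inj E] := ltngtP x y; first exact: W.
    by apply: (W y x) => //; rewrite eq_sym.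
  by rewrite E eqxx in xy.
exists (y - x)%N, (Num.floor (y%:R * alpha) - Num.floor (x%:R * alpha)).
split.
  have := ltn_ord y; rewrite subn_gt0 xlty/= ltnS leq_subLR.
  by move=> /leq_trans; apply; rewrite leq_addl.
have -> : (y - x)%:R * alpha - (Num.floor (y%:R * alpha) - Num.floor (x%:R * alpha))%:~R
    = f y - f x.
  by rewrite natrB ?(ltnW xlty)// intrB /f /frac_part; ring.
have := truncn_itv (f0 x); have := truncn_itv (f0 y); rewrite !hE hxy.
set t := val (h y); rewrite -natr1 => /andP[y1 y2] /andP[x1 x2].
rewrite -(ltr_pM2l n0) divff ?gt_eqF// -{1}[n%:R]ger0_norm ?(ltW n0)// -normrM.
by rewrite ltr_norml; apply/andP; split; lra.
Qed.

(* The points [i alpha], [i < q], are within [1/N] of the points [i p / q],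
   which for coprime [p] and [q] are equidistributed modulo 1. *)
Lemma rotation_covering (R : realType) (alpha : R) (N : nat) : (0 < N)%N ->
  exists q : nat, exists p : int,
    [/\ (0 < q <= N)%N, `|q%:R * alpha - p%:~R| < N%:R^-1 &
      forall x : R, exists i : nat, exists m : int, (i < q)%N /\
        `|x - i%:R * alpha - m%:~R| <= q%:R^-1 + N%:R^-1].
Proof.
move=> N0; have [q0 [p0 [/andP[q00 q0N] pq0]]] := dirichlet_approx alpha N0.
(* Division of [p0] and [q0] by their gcd [g] makes [p] invertible modulo [q] and does not enlarge
   [|q alpha - p|]. *)
have [u [v uv]] := Bezoutz p0 q0%:Z.
set g := gcdz p0 q0%:Z in uv.
have [p pE] : exists p, p0 = p * g by apply/dvdzP; rewrite dvdz_gcdl.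
have [q' qE] : exists q, q0%:Z = q * g by apply/dvdzP; rewrite dvdz_gcdr.
have g0 : 0 < g.
  by rewrite /g /gcdz ltz_nat gcdn_gt0 q00 orbT.
have : 0 < q' by rewrite -(pmulr_lgt0 _ g0) -qE; lia.
case: q' qE => // q qE q_gt0.
have {}uv : u * p + v * q = 1.
  apply: (mulIf (lt0r_neq0 g0)); rewrite mul1r -[RHS]uv pE qE; ring.
have q0r : 0 < q%:R :> R by rewrite ltr0n; lia.
have qq0 : (q <= q0)%N.
  have : q%:Z * 1 <= q%:Z * g by rewrite ler_wpM2l//; lia.
  by rewrite -qE; lia.
have th : `|q%:R * alpha - p%:~R| < N%:R^-1.
  apply: le_lt_trans pq0.
  have -> : q0%:R * alpha - p0%:~R = g%:~R * (q%:R * alpha - p%:~R).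
    by rewrite -[q0%:R]/(q0%:~R) qE pE !intrM; ring.
  rewrite normrM ler_peMl// ger0_norm; last by rewrite ler0z ltW.
  by rewrite ler1z; clear -g0; lia.
exists q, p; split=> // [|x]; first by apply/andP; split; lia.
set j := Num.floor (q%:R * x).
have := modz_ge0 (u * j) (lt0r_neq0 q_gt0).
have := ltz_pmod (u * j) q_gt0.
have := divz_eq (u * j) q.
case: (modz (u * j) q) => // i; set l := divz _ _ => ujE iq _.
exists i, (v * j + l * p); split; first lia.
have ipE : i%:~R * p%:~R = j%:~R - q%:R * (v * j + l * p)%:~R :> R.
  rewrite -[q%:R]/(q%:~R) -!intrM -intrB; congr (_%:~R).
  have -> : Posz i = u * j - l * q by rewrite ujE addrAC subrr add0r.
  rewrite -[X in _ = X - _]mul1r -uv; ring.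
have := floor_le (q%:R * x); have := floorD1_gt (q%:R * x); rewrite -/j intrD1 => j1 j2.
have -> : x - i%:R * alpha - (v * j + l * p)%:~R =
    (q%:R * x - j%:~R) / q%:R - i%:R / q%:R * (q%:R * alpha - p%:~R).
  have -> : j%:~R = i%:R * p%:~R + q%:R * (v * j + l * p)%:~R :> R.
    by rewrite -[i%:R]/(i%:~R) ipE; ring.
  by field; rewrite gt_eqF.
apply: (le_trans (ler_normB _ _)); apply: lerD.
  rewrite ger0_norm; last by rewrite divr_ge0 ?subr_ge0// ltW.
  by apply: ler_piMl; [rewrite invr_ge0 ltW|lra].
rewrite normrM; apply: le_trans (ltW th); rewrite ler_piMl//.
by rewrite ger0_norm ?divr_ge0// ler_pdivrMr// mul1r ler_nat; lia.
Qed.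

Section badly_approximable_rotation.
Variables (R : realType) (alpha c : R).
Hypothesis c_gt0 : 0 < c.
Hypothesis alpha_c : forall k p : int, k != 0 ->
  c <= `|k%:~R| * `|k%:~R * alpha - p%:~R|.

(** Since [c <= q |q alpha - p| <= q / N], the term [1 / q] in [rotation_covering] is at most
    [c^-1 / N]. *)
Lemma bad_covering (N : nat) : (0 < N)%N ->
  exists q : nat, exists p : int,
    [/\ (0 < q <= N)%N, `|q%:R * alpha - p%:~R| < N%:R^-1 &
      forall x : R, exists i : nat, exists m : int, (i < q)%N /\
        `|x - i%:R * alpha - m%:~R| <= (c^-1 + 1) / N%:R].
Proof.
move=> N0; have [q [p [qN qp cov]]] := rotation_covering alpha N0.
exists q, p; split=> // x; have [i [m [iq xim]]] := cov x; exists i, m; split=> //.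
apply: (le_trans xim); rewrite mulrDl mul1r lerD2r.
have q0 : 0 < q%:R :> R by rewrite ltr0n; case/andP: qN.
have Nr0 : 0 < N%:R :> R by rewrite ltr0n.
have := @alpha_c q p; rewrite -[q%:~R]/(q%:R) normr_nat => /(_ _)/le_trans cq.
have {}cq : c <= q%:R * N%:R^-1.
  by apply: cq; [lia|rewrite ler_pM2l// ltW].
by rewrite -invfM lef_pV2 ?posrE ?mulr_gt0// -ler_pdivlMr.
Qed.

Lemma orbit_dense (x e : R) : 0 < e ->
  exists i : nat, exists m : int, `|x - i%:R * alpha - m%:~R| < e.
Proof.
move=> e0; set N := (Num.bound ((c^-1 + 1) / e)).
have K0 : 0 < c^-1 + 1 by rewrite addr_gt0// invr_gt0.
have NK : (c^-1 + 1) / e < N%:R by apply: archi_boundP; rewrite divr_ge0// ltW.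
have Nr0 : 0 < N%:R :> R by apply: le_lt_trans NK; rewrite divr_ge0// ltW.
have N0 : (0 < N)%N by rewrite ltr0n in Nr0.
have [q [p [_ _ /(_ x)[i [m [_ im]]]]]] := bad_covering N0.
exists i, m; apply: (le_lt_trans im).
by rewrite ltr_pdivrMr// mulrC -ltr_pdivrMr.
Qed.

(* If every large [N] were bad, the pairs [(k, p)] for [N] and [N + 1] would
   have to coincide, hence witness [tau = 2 k alpha - p]. *)
Lemma separated_scales (tau : R) :
  (forall k p : int, tau != 2 * k%:~R * alpha - p%:~R) ->
  exists2 d : R, 0 < d & forall N0 : nat, exists2 N : nat, (N0 <= N)%N &
    forall k p : int, `|k| <= N%:Z ->
      d / N%:R <= `|p%:~R + tau - 2 * k%:~R * alpha|.
Proof.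
(* Let two pairs come within [d / N]. With [d <= c / 16], distinct [k] would violate [alpha_c], as
   [|2 (k - k')| <= 8 N]; with [d <= 1/2], equal [k] forces equal [p]. *)
move=> tauE; pose d := Num.min 2^-1 (c / 16).
exists d => [|N0]; first by rewrite lt_min invr_gt0 divr_gt0// ltr0n.
have d2 : d <= 2^-1 by rewrite ge_min lexx.
have dc : d <= c / 16 by rewrite ge_min lexx orbT.
have d0 : 0 < d by rewrite lt_min invr_gt0 divr_gt0// ltr0n.
apply: contrapT => bad.
pose D (k p : int) := `|p%:~R + tau - 2 * k%:~R * alpha|.
have badN N : (N0 <= N)%N -> exists k p, `|k| <= N%:Z /\ D k p < d / N%:R.
  move=> NN; apply: contrapT => H; apply: bad; exists N => // k p kN.
  by rewrite leNgt; apply/negP => L; apply: H; exists k, p.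
have step N k p k' p' : (1 < N)%N -> `|k| <= N%:Z -> D k p < d / N%:R ->
    `|k'| <= N.+1%:Z -> D k' p' < d / N.+1%:R -> k = k' /\ p = p'.
  move=> N1 kN Dk kN' Dk'.
  have Nr : 2 <= N%:R :> R by rewrite ler_nat.
  have Dk2 : D k' p' < d / N%:R.
    apply: lt_le_trans Dk' _; rewrite ler_pM2l// lef_pV2 ?posrE ?ler_nat ?ltr0n//; lia.
  have E : `|(2 * (k - k'))%:~R * alpha - (p - p')%:~R| < 2 * d / N%:R.
    have -> : (2 * (k - k'))%:~R * alpha - (p - p')%:~R =
      (p'%:~R + tau - 2 * k'%:~R * alpha) - (p%:~R + tau - 2 * k%:~R * alpha).
      by rewrite intrM !intrB; ring.
    apply: (le_lt_trans (ler_normB _ _)).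
    have -> : 2 * d / N%:R = d / N%:R + d / N%:R by ring.
    exact: ltrD.
  have kk : k = k'.
    apply/eqP; apply/negPn/negP => kk.
    have K0 : 2 * (k - k') != 0 by clear -kk; lia.
    have := @alpha_c (2 * (k - k')) (p - p') K0.
    have : `|(2 * (k - k'))%:~R| <= 8 * N%:R :> R.
      rewrite -intr_norm -[8 * N%:R]/((8%:~R) * (N%:~R)) -intrM ler_int.
      by clear -kN kN' N1; lia.
    set a := `|_|; set b := `|_| in E * => aN cab.
    have b0 : 0 <= b by exact: normr_ge0.
    have : a * b < 8 * N%:R * (2 * d / N%:R).
      apply: (@le_lt_trans _ _ (8 * N%:R * b)); first by rewrite ler_wpM2r.
      by rewrite ltr_pM2l//; lra.
    have -> : 8 * N%:R * (2 * d / N%:R) = 16 * d by field; rewrite gt_eqF//; lra.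
    lra.
  split=> //; move: E; rewrite kk subrr mulr0 mul0r sub0r normrN -intr_norm => E.
  suff : `|p - p'| < 1 by clear; lia.
  rewrite -(ltr_int R); apply: lt_le_trans E _.
  rewrite ler_pdivrMr//; lra.
have [k [p [kN Dk]]] := badN (maxn N0 2) (leq_maxl _ _).
(* One pair now serves every large [N], which forces [D k p = 0] against [tauE]. *)
have all N : (maxn N0 2 <= N)%N -> `|k| <= N%:Z /\ D k p < d / N%:R.
  elim: N => [|N IH]; first by rewrite leqn0 => /eqP E; rewrite -E.
  rewrite leq_eqVlt => /predU1P[<- //|NN]; have [kN' Dk'] := IH NN.
  have [k' [p' [kN2 Dk2]]] := badN N.+1 ltac:(lia).
  have N1 : (1 < N)%N by clear -NN; lia.
  by have [-> ->] := step N k p k' p' N1 kN' Dk' kN2 Dk2.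
have := tauE k p; rewrite -subr_eq0 opprB addrCA addrA -normr_gt0 -/(D k p) => Dkp.
have DE : 0 < D k p by move: Dkp; congr (_ < `|_|); ring.
pose N := maxn (maxn N0 2) (Num.bound (d / D k p)).
have [_] := all N (leq_maxl _ _); rewrite ltr_pdivlMr; last by rewrite ltr0n /N; lia.
apply/negP; rewrite -leNgt mulrC -ler_pdivrMr//.
apply: (@le_trans _ _ (Num.bound (d / D k p))%:R).
  by apply: ltW; apply: archi_boundP; rewrite divr_ge0// ltW.
by rewrite ler_nat leq_maxr.
Qed.

End badly_approximable_rotation.

(** * The step function and its Birkhoff sums *)


Lemma frac_partDz (R : realType) (x : R) (m : int) :
  frac_part (x + m%:~R) = frac_part x.
Proof.
by rewrite /frac_part floorDrz ?intr_int// intrKfloor intrD; ring.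
Qed.

Lemma step_funDz (R : realType) (x : R) (m : int) :
  step_fun (x + m%:~R) = step_fun x.
Proof. by rewrite /step_fun frac_partDz. Qed.

Lemma step_fun_pm (R : realType) (x : R) : step_fun x = 1 \/ step_fun x = -1.
Proof. by rewrite /step_fun; case: ifP; [left|right]. Qed.

Lemma step_fun_pos (R : realType) (p : int) (y : R) :
  0 <= y < 2^-1 -> step_fun (p%:~R + y) = 1.
Proof.
move=> /andP[y0 y1]; rewrite addrC step_funDz /step_fun /frac_part.
rewrite (_ : Num.floor y = 0) ?subr0 ?y1//.
by apply: floor_def; rewrite y0 add0r/=; lra.
Qed.

Lemma step_fun_neg (R : realType) (p : int) (y : R) :
  - 2^-1 <= y < 0 -> step_fun (p%:~R + y) = -1.
Proof.
move=> /andP[y0 y1]; rewrite addrC step_funDz /step_fun /frac_part.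
rewrite (_ : Num.floor y = -1); first by rewrite ifF//; apply/negP; lra.
by apply: floor_def; rewrite subrr y1 andbT; lra.
Qed.

Lemma step_funDhalf (R : realType) (x : R) : step_fun (x + 2^-1) = - step_fun x.
Proof.
have := frac_part_ge0 x; have := frac_part_lt1 x.
have xE : x = (Num.floor x)%:~R + frac_part x by rewrite /frac_part; ring.
set f := frac_part x in xE *; set n := Num.floor x in xE *; rewrite xE => f1 f0.
have [f2|f2] := ltP f 2^-1.
  rewrite [RHS](congr1 _ (step_fun_pos n _)) ?f0//.
  have -> : n%:~R + f + 2^-1 = (n + 1)%:~R + (f - 2^-1) by rewrite intrD; lra.
  by rewrite step_fun_neg//; lra.
have -> : n%:~R + f + 2^-1 = (n + 1)%:~R + (f - 2^-1) by rewrite intrD; lra.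
have -> : n%:~R + f = (n + 1)%:~R + (f - 1) by rewrite intrD; lra.
by rewrite step_fun_pos ?step_fun_neg ?opprK//; lra.
Qed.

(** [step_fun] is constant on each [[p / 2, (p + 1) / 2[]; with [p] the floor of [2 y], the point
    [x] must lie to the left of this cell. *)
Lemma step_fun_jump (R : realType) (x y : R) : x <= y ->
  step_fun x != step_fun y -> exists p : int, x < p%:~R / 2 <= y.
Proof.
move=> xy; have := floor_le (2 * y); have := floorD1_gt (2 * y).
set p := Num.floor (2 * y) => p1 p2 H; exists p.
rewrite ltNge; apply/andP; split; last lra.
apply: contra H => px; rewrite intrD1 in p1.
have -> : x = p%:~R / 2 + (x - p%:~R / 2) by ring.
have -> : y = p%:~R / 2 + (y - p%:~R / 2) by ring.
have [k pk] : exists k : int, p = 2 * k \/ p = 2 * k + 1.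
  by exists (p %/ 2)%Z; have := divz_eq p 2; have := modz_ge0 p (isT : 2 != 0 :> int);
    have := ltz_pmod p (isT : 0 < 2 :> int); lia.
have kk (z : R) : 0 <= z < 2^-1 ->
  step_fun (p%:~R / 2 + z) = if p == 2 * k then 1 else -1.
  move=> z01; case: pk => pk.
    rewrite pk eqxx intrM (_ : 2%:~R * k%:~R / 2 = k%:~R :> R).
      by rewrite step_fun_pos.
    by rewrite mulrC mulrA mulVf ?mul1r.
  rewrite ifF; last by apply/negP; lia.
  have -> : p%:~R / 2 + z = (k + 1)%:~R + (z - 2^-1) :> R.
    by rewrite pk !intrD intrM; lra.
  by rewrite step_fun_neg//; lra.
by rewrite !kk//; lra.
Qed.

Section birkhoff.
Variables (R : realType) (alpha : R).
Local Notation S := (birkhoff_sum alpha).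

Lemma birkhoff_sumS n x : S n.+1 x = S n x + step_fun (x + n%:R * alpha).
Proof. by rewrite /birkhoff_sum big_ord_recr. Qed.

Lemma birkhoff_sum0 x : S 0 x = 0.
Proof. by rewrite /birkhoff_sum big_ord0. Qed.

Lemma birkhoff_sum1 x : S 1 x = step_fun x.
Proof. by rewrite birkhoff_sumS birkhoff_sum0 mul0r addr0 add0r. Qed.

Lemma birkhoff_sumDz n x (m : int) : S n (x + m%:~R) = S n x.
Proof. by apply: eq_bigr => i _; rewrite addrAC step_funDz. Qed.

Lemma birkhoff_sum_frac n (x y : R) : S n (frac_part x + y) = S n (x + y).
Proof. by rewrite /frac_part addrAC -mulrNz birkhoff_sumDz. Qed.

Lemma birkhoff_sumD m n x : S (m + n) x = S m x + S n (x + m%:R * alpha).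
Proof.
elim: n => [|n IH]; first by rewrite addn0 birkhoff_sum0 addr0.
rewrite addnS !birkhoff_sumS IH -addrA; congr (_ + (_ + step_fun _)).
by rewrite natrD; ring.
Qed.

Lemma birkhoff_sumDhalf n x : S n (x + 2^-1) = - S n x.
Proof.
by rewrite /birkhoff_sum -sumrN; apply: eq_bigr => i _; rewrite addrAC step_funDhalf.
Qed.

Lemma birkhoff_sum_le n x : `|S n x| <= n%:Z.
Proof.
elim: n => [|n IH]; first by rewrite birkhoff_sum0.
rewrite birkhoff_sumS; move: IH; set s := S n x.
by case: (step_fun_pm (x + n%:R * alpha)) => ->; lia.
Qed.

Lemma birkhoff_sum_parity n x : exists k : int, S n x = n%:Z + 2 * k.
Proof.
elim: n => [|n [k IH]]; first by exists 0; rewrite birkhoff_sum0.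
rewrite birkhoff_sumS IH.
by case: (step_fun_pm (x + n%:R * alpha)) => ->; [exists k|exists (k - 1)]; lia.
Qed.

Lemma cocycle_Negz n x :
  cocycle alpha (Negz n) x = - S n.+1 (x - n.+1%:R * alpha).
Proof.
rewrite /cocycle /rotation -[frac_part _]addr0 birkhoff_sum_frac addr0.
by rewrite NegzE mulrNz mulNr.
Qed.

Lemma cocycle_succ n x :
  cocycle alpha (n + 1) x = cocycle alpha n x + step_fun (x + n%:~R * alpha).
Proof.
case: n => n; first by rewrite -PoszD addn1 /= birkhoff_sumS.
case: n => [|n].
  rewrite (_ : Negz 0 + 1 = 0)// cocycle_Negz /= birkhoff_sum0.
  rewrite birkhoff_sumS birkhoff_sum0 add0r mul0r addr0.
  by rewrite NegzE mulrNz mulNr addNr.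
rewrite (_ : Negz n.+1 + 1 = Negz n); last by lia.
rewrite !cocycle_Negz.
have := birkhoff_sumD 1 n.+1 (x - n.+2%:R * alpha).
rewrite add1n => ->; rewrite birkhoff_sum1.
have -> : x - n.+2%:R * alpha + 1%:R * alpha = x - n.+1%:R * alpha.
  by rewrite -[n.+2%:R]natr1; ring.
rewrite opprD NegzE mulrNz mulNr -[n.+2%:~R]/(n.+2%:R).
by rewrite addrAC addNr add0r.
Qed.

Lemma cocycleD m n x :
  cocycle alpha (m + n) x = cocycle alpha m x + cocycle alpha n (x + m%:~R * alpha).
Proof.
(* [a_(m+k)(x) - a_k(x + m alpha)] does not depend on [k], so it keeps its value at 0 under
   induction in both directions. *)
have step k : cocycle alpha (m + (k + 1)) x - cocycle alpha (k + 1) (x + m%:~R * alpha)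
    = cocycle alpha (m + k) x - cocycle alpha k (x + m%:~R * alpha).
  rewrite addrA !cocycle_succ.
  rewrite (_ : x + (m + k)%:~R * alpha = x + m%:~R * alpha + k%:~R * alpha).
    ring.
  by rewrite intrD; ring.
suff : cocycle alpha (m + n) x - cocycle alpha n (x + m%:~R * alpha) = cocycle alpha m x.
  by move=> <-; rewrite subrK.
elim/int_ind: n => [|n IH|n IH]; first by rewrite addr0 /= birkhoff_sum0 subr0.
  by rewrite -[n.+1]addn1 PoszD step.
have E : - n%:Z = - n.+1%:Z + 1 by lia.
by rewrite -IH E step.
Qed.

Lemma cocycleDz n x (m : int) : cocycle alpha n (x + m%:~R) = cocycle alpha n x.
Proof.
by case: n => n; rewrite ?cocycle_Negz /= ?[x + _ - _]addrAC birkhoff_sumDz.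
Qed.

Lemma cocycle_le n x : `|cocycle alpha n x| <= `|n|.
Proof.
case: n => n; first exact: birkhoff_sum_le.
by rewrite cocycle_Negz normrN; apply: le_trans (birkhoff_sum_le _ _) _; lia.
Qed.

Lemma cocycle_parity n x : exists k : int, cocycle alpha n x = n + 2 * k.
Proof.
case: n => n; first exact: birkhoff_sum_parity.
rewrite cocycle_Negz; have [k ->] := birkhoff_sum_parity n.+1 (x - n.+1%:R * alpha).
by exists (- k); lia.
Qed.

Lemma cocycleDhalf n x : cocycle alpha n (x + 2^-1) = - cocycle alpha n x.
Proof.
by case: n => n; rewrite ?cocycle_Negz /= ?[x + _ - _]addrAC birkhoff_sumDhalf.
Qed.

(* [a_n(x + k alpha) - a_n(x) = a_k(x + n alpha) - a_k(x)]. *)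
Lemma cocycle_shift_le n k x :
  `|cocycle alpha n (x + k%:~R * alpha) - cocycle alpha n x| <= 2 * `|k|.
Proof.
have h := cocycleD n k x; have h' := cocycleD k n x; rewrite addrC h in h'.
have -> : cocycle alpha n (x + k%:~R * alpha) - cocycle alpha n x =
    cocycle alpha k (x + n%:~R * alpha) - cocycle alpha k x.
  by apply/eqP; rewrite subr_eq addrAC -(addrC (cocycle alpha n x)) h' addrC addKr.
apply: (le_trans (ler_normB _ _)).
by rewrite mulr_natl mulr2n lerD ?cocycle_le.
Qed.

End birkhoff.

(** * Jumps of the Birkhoff sums *)


Section jumps.
Variables (R : realType) (alpha c : R).
Hypothesis c_gt0 : 0 < c.
Hypothesis alpha_c : forall k p : int, k != 0 ->
  c <= `|k%:~R| * `|k%:~R * alpha - p%:~R|.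
Local Notation S := (birkhoff_sum alpha).

(** For [i != j], [alpha_c] at the nonzero integer [2 (i - j)], of size at most [2 N], keeps
    [(i - j) alpha] at distance [c / (4 N)] from the half-integers, where [step_fun] jumps. *)
Lemma half_integer_gap (N i j : nat) (p : int) : (i < N)%N -> (j < N)%N ->
  `|p%:~R / 2 - (i%:R - j%:R) * alpha| < c / 4 / N%:R -> i = j.
Proof.
move=> iN jN H; apply/eqP; apply/negPn/negP => ij.
have N0 : 0 < N%:R :> R by rewrite ltr0n; clear -iN; lia.
have k0 : 2 * (i%:Z - j%:Z) != 0 by clear -ij; lia.
have := alpha_c p k0; apply/negP; rewrite -ltNge.
have kN : `|(2 * (i%:Z - j%:Z))%:~R| <= 2 * N%:R :> R.
  rewrite -intr_norm -[2 * N%:R]/((2%:~R) * (N%:~R)) -intrM ler_int.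
  by clear -iN jN; lia.
have -> : (2 * (i%:Z - j%:Z))%:~R * alpha - p%:~R =
    - (2 * (p%:~R / 2 - (i%:R - j%:R) * alpha)).
  by rewrite intrM intrB -[i%:~R]/(i%:R) -[j%:~R]/(j%:R); field.
rewrite normrN normrM (ger0_norm (ler0n _ _)).
apply: (@le_lt_trans _ _ (2 * N%:R * (2 * `|p%:~R / 2 - (i%:R - j%:R) * alpha|))).
  by rewrite ler_wpM2r.
have -> : c = 2 * N%:R * (2 * (c / 4 / N%:R)) by field; rewrite gt_eqF.
by rewrite ltr_pM2l ?mulr_gt0// ltr_pM2l.
Qed.

Lemma jump_unique (N i j : nat) (z w : R) : (i < N)%N -> (j < N)%N ->
  `|z - w| < c / 4 / N%:R ->
  step_fun (z + i%:R * alpha) != step_fun (w + i%:R * alpha) ->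
  step_fun (z + j%:R * alpha) != step_fun (w + j%:R * alpha) -> i = j.
Proof.
move=> iN jN; wlog zw : z w / z <= w.
  move=> W; have [/W//|/ltW/W {}W] := leP z w.
  move=> zwN H1 H2.
  by apply: W; [rewrite distrC|rewrite eq_sym|rewrite eq_sym].
rewrite distrC ger0_norm ?subr_ge0// => zwN.
move=> /step_fun_jump[|p /andP[p1 p2]]; first by rewrite lerD2r.
move=> /step_fun_jump[|p' /andP[p1' p2']]; first by rewrite lerD2r.
apply: (@half_integer_gap N i j (p - p')) => //.
by rewrite intrB ltr_norml; apply/andP; split; lra.
Qed.

(** At most one term changes between [z] and [w], by at most 2. *)
Lemma birkhoff_near (N n : nat) (z w : R) : (n <= N)%N ->
  `|z - w| < c / 4 / N%:R -> `|S n z - S n w| <= 2.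
Proof.
move=> nN zw; rewrite /birkhoff_sum -sumrB.
have le2 (x y : R) : `|step_fun x - step_fun y : int| <= 2.
  by case: (@step_fun_pm R x) => ->; case: (@step_fun_pm R y) => ->.
have [[i H]|H] := pselect (exists i : 'I_n,
    step_fun (z + i%:R * alpha) != step_fun (w + i%:R * alpha)).
  rewrite (bigD1 i)//= big1 ?addr0// => j ji; apply/eqP; rewrite subr_eq0.
  apply: contraNT ji => K; apply/eqP/val_inj/esym.
  apply: (@jump_unique N i j z w) => //; exact: leq_trans nN.
rewrite big1// => i _; apply/eqP; rewrite subr_eq0; apply/negPn/negP => K.
by apply: H; exists i.
Qed.

(** The segment from [z] to [w] is cut into [m] steps short enough for [birkhoff_near]; [m] depends
    on [K] and [c] only. *)
Lemma birkhoff_local_bound (K : R) : 0 <= K -> exists M : int,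
  forall (N n : nat) (z w : R), (0 < N)%N -> (n <= N)%N ->
    `|z - w| <= K / N%:R -> `|S n z - S n w| <= M.
Proof.
move=> K0; set m := (Num.bound (4 * K / c)).+1.
exists (2 * m%:Z) => N n z w N0 nN zw.
have Nr0 : 0 < N%:R :> R by rewrite ltr0n.
have m0 : 0 < m%:R :> R by rewrite ltr0n.
set h := (w - z) / m%:R.
have hN : `|h| < c / 4 / N%:R.
  rewrite normrM normfV (ger0_norm (ltW m0)) distrC ltr_pdivrMr//.
  apply: le_lt_trans zw _; rewrite mulrAC ltr_pM2r ?invr_gt0//.
  have Km : 4 * K / c < m%:R.
    apply: (@lt_trans _ _ (Num.bound (4 * K / c))%:R); last by rewrite ltr_nat.
    by apply: archi_boundP; rewrite divr_ge0 ?mulr_ge0// ltW.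
  by rewrite ltr_pdivrMr// in Km; lra.
have step k : `|S n z - S n (z + k%:R * h)| <= 2 * k%:Z.
  elim: k => [|k IH]; first by rewrite mul0r addr0 subrr.
  have : `|S n (z + k%:R * h) - S n (z + k.+1%:R * h)| <= 2.
    apply: (@birkhoff_near N) => //.
    have -> : z + k%:R * h - (z + k.+1%:R * h) = - h by rewrite -natr1; ring.
    by rewrite normrN.
  by move: IH; clear; lia.
have := step m; congr (`|_ - S n _| <= _).
by rewrite /h mulrC divfK ?gt_eqF// addrC subrK.
Qed.

(* The differences [a_q(x + i alpha) - a_q(x) = a_i(x + q alpha) - a_i(x)] are
   bounded, and [1/2] is close to some [i alpha] while
   [a_q(x + 1/2) = - a_q(x)]. *)
Lemma birkhoff_rigid_bound (K : R) : 0 <= K -> exists M : int,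
  forall (N q : nat) (p : int), (0 < N)%N -> (q <= N)%N ->
    `|q%:R * alpha - p%:~R| < N%:R^-1 ->
    (forall x : R, exists i : nat, exists m : int, (i < q)%N /\
        `|x - i%:R * alpha - m%:~R| <= K / N%:R) ->
    forall x, `|S q x| <= M.
Proof.
move=> K0; have [M1 M1P] := birkhoff_local_bound K0.
have [M2 M2P] := birkhoff_local_bound (@ler01 R).
exists (M1 + M2) => N q p N0 qN qp cov x.
have [i [m [iq im]]] := cov 2^-1.
have := M1P N q (x + 2^-1) (x + i%:R * alpha + m%:~R) N0 qN.
have -> : x + 2^-1 - (x + i%:R * alpha + m%:~R) = 2^-1 - i%:R * alpha - m%:~R.
  by ring.
move=> /(_ im); rewrite birkhoff_sumDhalf birkhoff_sumDz => H1.
have := M2P N i (x + q%:R * alpha - p%:~R) x N0.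
have -> : x + q%:R * alpha - p%:~R - x = q%:R * alpha - p%:~R by ring.
have E : S i (x + q%:R * alpha - p%:~R) = S i (x + q%:R * alpha).
  by rewrite -mulrNz birkhoff_sumDz.
rewrite mul1r E => /(_ _ (ltW qp)) H2.
have {}H2 := H2 (ltnW (leq_trans iq qN)).
(* [H1] bounds the sum of [a_q(x)] and [a_q(x + i alpha)]; [H2] bounds their difference, through the
   two expansions of [a_(q+i)(x)]. *)
have := birkhoff_sumD alpha q i x; rewrite addnC birkhoff_sumD.
move: H1 H2; set a := S q x; set b := S q _; set e := S i x; set f := S i _.
by clear; lia.
Qed.

Section two_offsets.
Variables s1 s2 : R.
Hypothesis s12 : forall k p : int, 2 * (s1 - s2) != 2 * k%:~R * alpha - p%:~R.

(** [bad_covering] supplies a jump of the first sum near [x], [half_integer_gap] keeps its other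
    jumps away, and [separated_scales] those of the second sum. *)
Lemma isolated_jumps : exists M : int, exists K r : R, [/\ 0 < K, 0 < r &
  forall N0 : nat, exists N q : nat, exists p : int,
    [/\ (N0 <= N)%N, `|q%:R * alpha - p%:~R| < N%:R^-1 &
      forall x : R, exists (d : R) (v1 v2 : int),
        [/\ `|x - d| <= K / N%:R, `|v1| <= M /\ `|v2| <= M,
            forall y, d - r / N%:R < y < d ->
              S q (y + s1) = v1 /\ S q (y + s2) = v2 &
            forall y, d <= y < d + r / N%:R ->
              S q (y + s1) = v1 + 2 /\ S q (y + s2) = v2]]].
Proof.
have K0 : 0 < c^-1 + 1 by rewrite addr_gt0// invr_gt0.
have [M MP] := birkhoff_rigid_bound (ltW K0).
have [d d0 dP] := separated_scales c_gt0 alpha_c s12.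
(* The three bounds serve [half_integer_gap] for the first sum, [separated_scales] for the second,
   and the constancy of [step_fun] on each side of the jump. *)
pose r := Num.min (Num.min (c / 8) (d / 4)) 4^-1.
have rc : r <= c / 8 by rewrite /r !ge_min lexx.
have rd : r <= d / 4 by rewrite /r !ge_min lexx orbT.
have r4 : r <= 4^-1 by rewrite /r !ge_min lexx !orbT.
have r0 : 0 < r by rewrite /r !lt_min invr_gt0 !divr_gt0// ?ltr0n.
exists M, (c^-1 + 1), r; split=> // N0.
have [N NN0 NP] := dP (maxn N0 1).
have N_gt0 : (0 < N)%N by clear -NN0; lia.
have Nr0 : 0 < N%:R :> R by rewrite ltr0n.
have [q [p [/andP[q0 qN] qp cov]]] := bad_covering c_gt0 alpha_c N_gt0.
exists N, q, p; split=> //; first by clear -NN0; lia.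
move=> x; have [i0 [m0 [i0q xim]]] := cov (- (x + s1)).
(* At [D] the term of index [i0] is evaluated at the integer [- m0], where [step_fun] jumps from -1
   to 1. *)
set D := (- m0)%:~R - s1 - i0%:R * alpha.
have rN : r / N%:R <= 4^-1.
  rewrite ler_pdivrMr//; apply: (le_trans r4).
  by rewrite ler_peMr// (ler_nat _ 1%N).
have rcN : 2 * (r / N%:R) <= c / 4 / N%:R.
  by rewrite mulrA ler_pM2r ?invr_gt0//; lra.
have rdN : 4 * (r / N%:R) <= d / N%:R.
  by rewrite mulrA ler_pM2r ?invr_gt0//; lra.
set e := r / N%:R in rN rcN rdN *.
have e0 : 0 < e by rewrite divr_gt0.
clear rc rd r4.
(* A jump of the second sum in the window would put a half-integer close to [D + s2 + i alpha];
   doubled, this contradicts [NP] at [i - i0]. *)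
have S2 (y z : R) : `|y - D| <= e -> `|z - D| <= e -> S q (y + s2) = S q (z + s2).
  wlog yz : y z / y <= z.
    by move=> W yD zD; have [/W|/ltW/W/(_ zD yD)] := leP y z; first exact.
  move=> yD zD; apply: eq_bigr => -[i iq] _; apply/eqP/negPn/negP => /= H.
  have [|P /andP[P1 P2]] := step_fun_jump _ H; first by rewrite !lerD2r.
  have iN : `|i%:Z - i0%:Z| <= N%:Z by clear -iq i0q qN; lia.
  have := NP (i%:Z - i0%:Z) (P + 2 * m0) iN; apply/negP; rewrite -ltNge.
  apply: lt_le_trans rdN.
  have -> : (P + 2 * m0)%:~R + 2 * (s1 - s2) - 2 * (i%:Z - i0%:Z)%:~R * alpha =
      2 * (P%:~R / 2 - s2 - i%:R * alpha - D).
    by rewrite /D intrD intrM intrB mulrNz -[i%:~R]/(i%:R) -[i0%:~R]/(i0%:R); field.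
  rewrite normrM (ger0_norm (ler0n _ _)).
  move: yD zD; rewrite !ler_norml => /andP[? ?] /andP[? ?].
  suff : `|P%:~R / 2 - s2 - i%:R * alpha - D| <= e by lra.
  by rewrite ler_norml; apply/andP; split; lra.
(* With the term [i0] removed, the first sum is constant on the window. *)
have S1 (y z : R) : `|y - D| <= e -> `|z - D| <= e ->
    S q (y + s1) - step_fun ((- m0)%:~R + (y - D)) =
    S q (z + s1) - step_fun ((- m0)%:~R + (z - D)).
  wlog yz : y z / y <= z.
    by move=> W yD zD; have [/W|/ltW/W/(_ zD yD)] := leP y z; first exact.
  move=> yD zD; rewrite /birkhoff_sum.
  rewrite (bigD1 (Ordinal i0q))//= [in RHS](bigD1 (Ordinal i0q))//=.
  have E u : u + s1 + i0%:R * alpha = (- m0)%:~R + (u - D) by rewrite /D; ring.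
  rewrite (E y) (E z) [LHS]addrAC [RHS]addrAC !subrr !add0r.
  apply: eq_bigr => -[i iq] /= ii0; apply/eqP/negPn/negP => H.
  have [|P /andP[P1 P2]] := step_fun_jump _ H; first by rewrite !lerD2r.
  suff iE : i = i0 by move: ii0; rewrite -val_eqE/= iE eqxx.
  apply: (@half_integer_gap N i i0 (P + 2 * m0));
    [exact: leq_trans qN|exact: leq_trans qN|].
  apply: lt_le_trans rcN.
  have -> : (P + 2 * m0)%:~R / 2 - (i%:R - i0%:R) * alpha =
      P%:~R / 2 - s1 - i%:R * alpha - D.
    by rewrite /D intrD intrM mulrNz; field.
  move: yD zD; rewrite !ler_norml => /andP[? ?] /andP[? ?].
  suff : `|P%:~R / 2 - s1 - i%:R * alpha - D| <= e by lra.
  by rewrite ler_norml; apply/andP; split; lra.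
have De : `|D - e / 2 - D| <= e by rewrite ler_norml; apply/andP; split; lra.
exists D, (S q (D - e / 2 + s1)), (S q (D - e / 2 + s2)); split.
- rewrite -normrN; congr (`|_| <= _): xim; rewrite /D mulrNz; ring.
- by split; exact: (MP N q p).
- move=> y /andP[y1 y2].
  have yD : `|y - D| <= e by rewrite ler_norml; apply/andP; split; lra.
  split; last exact: S2.
  have := S1 _ _ yD De; rewrite !step_fun_neg; first by move/addIr.
    by apply/andP; split; lra.
  by apply/andP; split; lra.
- move=> y /andP[y1 y2].
  have yD : `|y - D| <= e by rewrite ler_norml; apply/andP; split; lra.
  split; last exact: S2.
  have := S1 _ _ yD De; rewrite step_fun_pos ?step_fun_neg.
  + by move/eqP; rewrite subr_eq opprK -addrA => /eqP.
  + by apply/andP; split; lra.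
  + by apply/andP; split; lra.
Qed.

End two_offsets.
End jumps.

(** * Lebesgue measure on the line *)


Section lebesgue_facts.
Variable R : realType.
Local Notation mu := (@lebesgue_measure R).
Implicit Types (A B J P Q : set R).

Lemma measurable_fun_translation (c : R) :
  measurable_fun [set: R] (fun x : R => x + c).
Proof. by apply: measurable_funD; [exact: measurable_id|exact: measurable_cst]. Qed.

Lemma measurable_translation A (c : R) :
  measurable A -> measurable [set x | A (x + c)].
Proof.
move=> mA; rewrite -[X in measurable X]setTI.
exact: (measurable_fun_translation c).
Qed.

Lemma lebesgue_measure_translation A (c : R) :
  measurable A -> mu [set x | A (x + c)] = mu A.
Proof.
move=> mA; apply/esym.
pose f : R -> measurableTypeR R := fun x => x + c.
have mf : measurable_fun [set: R] f by exact: measurable_fun_translation.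
rewrite -[RHS]/(pushforward mu f A).
apply: (lebesgue_measure_unique _ mA) => //= _ [[a b]] _ <-.
rewrite /pushforward (_ : f @^-1` _ = `]a - c, b - c]%classic); last first.
  by apply/seteqP; split=> x /=; rewrite !in_itv/= ltrBlDr lerBrDr.
rewrite !lebesgue_measure_itv/= !lte_fin ltrD2r; case: ifP => // _.
by rewrite -!EFinB; congr (_%:E); ring.
Qed.

Lemma lebesgue_pos_sub A B : measurable A -> measurable B -> A `<=` B ->
  (0 < mu A)%E -> (0 < mu B)%E.
Proof. by move=> mA mB AB /lt_le_trans; apply; apply: le_measure; rewrite ?inE. Qed.

(** Otherwise [A] is a countable union of null fibers, enumerated by [unpickle]. *)
Lemma lebesgue_pos_fiber (V : countType) (f : R -> V) A : measurable A ->
  (forall v, measurable [set x | f x = v]) -> (0 < mu A)%E ->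
  exists v, (0 < mu (A `&` [set x | f x = v]))%E.
Proof.
move=> mA mf A0; apply: contrapT => H.
have neg v : mu.-negligible (A `&` [set x | f x = v]).
  apply/(negligibleP mu (measurableI _ _ mA (mf v))).
  apply: contrapT => N; apply: H; exists v.
  by rewrite lt_neqAle measure_ge0 andbT eq_sym; apply/eqP.
pose F n := if unpickle n is Some v then A `&` [set x | f x = v] else set0.
have : mu.-negligible A.
  have N : mu.-negligible (\bigcup_n F n).
    apply: negligible_bigcup => n; rewrite /F.
    by case: unpickle => [v|]; [exact: neg|exact: negligible_set0].
  apply: negligibleS N => x Ax.
  by exists (pickle (f x)) => //; rewrite /F pickleK.
by move/(negligibleP mu mA) => E; rewrite E ltxx in A0.
Qed.

(** [J] is covered by the set in question, the part of [P] outside [A], and a translate of the part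
    of [Q] outside [B]; the last two have total measure at most [2 e]. *)
Lemma lebesgue_overlap A B J P Q (t e : R) :
  measurable A -> measurable B -> measurable J -> measurable P -> measurable Q ->
  J `<=` P -> J `<=` [set x | Q (x + t)] ->
  (mu (P `\` A) <= e%:E)%E -> (mu (Q `\` B) <= e%:E)%E -> ((e + e)%:E < mu J)%E ->
  (0 < mu (J `&` (A `&` [set x | B (x + t)%R])))%E.
Proof.
move=> mA mB mJ mP mQ JP JQ PA QB eJ.
have mBt := measurable_translation t mB; have mQt := measurable_translation t mQ.
have mX : measurable (J `&` (A `&` [set x | B (x + t)%R])).
  by apply: measurableI => //; exact: measurableI.
rewrite lt_neqAle measure_ge0 andbT; apply/negP => /eqP/esym X0.
have : (mu J <= (e + e)%:E)%E; last by apply/negP; rewrite -ltNge.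
have mD : measurable (P `\` A) by exact: measurableD.
have mE : measurable [set x | (Q `\` B) (x + t)%R].
  by apply: measurable_translation; exact: measurableD.
have JU : J `<=` (J `&` (A `&` [set x | B (x + t)%R])) `|`
    ((P `\` A) `|` [set x | (Q `\` B) (x + t)%R]).
  move=> x Jx; have [Ax|nA] := pselect (A x); last by right; left; split=> //; exact: JP.
  have [Bx|nB] := pselect (B (x + t)); first by left.
  by right; right; split=> //; exact: JQ.
have mU : measurable ((P `\` A) `|` [set x | (Q `\` B) (x + t)%R]) by exact: measurableU.
apply: (@le_trans _ _ (mu ((J `&` (A `&` [set x | B (x + t)%R])) `|`
    ((P `\` A) `|` [set x | (Q `\` B) (x + t)%R])))).
  by apply: le_measure; rewrite ?inE//; exact: measurableU.
set X := J `&` _ in X0 mX *; set Y := P `\` A in PA mD mU *.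
set Z := [set x | _] in mE mU *.
have H1 : (mu (X `|` (Y `|` Z)) <= mu X + mu (Y `|` Z))%E by exact: measureU2.
have H2 : (mu (Y `|` Z) <= mu Y + mu Z)%E by exact: measureU2.
rewrite X0 add0e in H1; apply: (le_trans H1); apply: (le_trans H2).
rewrite EFinD leeD// lebesgue_measure_translation//; exact: measurableD.
Qed.

Lemma density_point A : measurable A -> (0 < mu A)%E ->
  exists x : R, forall e : R, 0 < e -> exists2 r0 : R, 0 < r0 &
    forall r, 0 < r < r0 -> (mu (ball x r `\` A) <= (e * r)%:E)%E.
Proof.
move=> mA A0; have := lebesgue_density mA; rewrite /prop_near1 => /= -[Z [mZ Z0 AZ]].
have [x [Ax Dx]] : exists x, A x /\
    (mu (A `&` ball x r) * (mu (ball x r))^-1)%E @[r --> 0^'+] --> (\1_A x)%:E.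
  apply: contrapT => H; suff : mu.-negligible A.
    by move/(negligibleP mu mA) => E; rewrite E ltxx in A0.
  exists Z; split=> // x Ax; apply: AZ => /= Dx; apply: H; exists x; split=> //.
exists x => e e0.
(* A ball of radius [r] has measure [2 r], so a density above [1 - e / 2] leaves less than [e r]
   uncovered. *)
have : nbhs ((\1_A x)%:E : \bar R) [set y | ((1 - e / 2)%:E < y)%E].
  rewrite indicE mem_set//.
  by apply: (@nbhs_open_ereal_gt _ 1 (fun z => z - e / 2)); lra.
move=> /Dx[r0 /= r00 H]; exists r0 => // r /andP[r1 r2].
have Hr : ball_ Num.norm 0 r0 r by rewrite /ball_/= sub0r normrN gtr0_norm.
have := H r Hr r1; rewrite -/mu.
have mB : measurable (ball x r) by exact: measurable_ball.
have mAB : measurable (A `&` ball x r) by exact: measurableI.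
have muB : mu (ball x r) = (r *+ 2)%:E by rewrite lebesgue_measure_ball// ltW.
have Bfin : (mu (ball x r) < +oo)%E by rewrite muB ltry.
have -> : mu (ball x r `\` A) = (mu (ball x r) - mu (A `&` ball x r))%E.
  by rewrite measureD// (setIC (ball x r) A).
have : (mu (A `&` ball x r) <= mu (ball x r))%E.
  by apply: le_measure; rewrite ?inE//; apply: subIsetr.
rewrite muB; have : (0 <= mu (A `&` ball x r))%E by exact: measure_ge0.
case: (mu (A `&` ball x r)) => [m _ _|_|]; last 2 first.
- by rewrite leye_eq.
- by rewrite leeNy_eq.
rewrite inver gt_eqF ?pmulrn_lgt0// -EFinM !lte_fin -EFinB lee_fin.
rewrite ltr_pdivlMr ?pmulrn_lgt0// -mulr_natl; lra.
Qed.

(** Ergodicity of a dense family of translations: one of them nearly carries a density point of [A]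
    to one of [B], and [lebesgue_overlap] applies to small balls around them. *)
Lemma dense_translates_meet (G : Type) (tau : G -> R) A B :
  (forall x e : R, 0 < e -> exists g, `|x - tau g| < e) ->
  measurable A -> measurable B -> (0 < mu A)%E -> (0 < mu B)%E ->
  exists g, (0 < mu (A `&` [set x | B (x + tau g)%R]))%E.
Proof.
move=> dense mA mB A0 B0.
have [a aP] := density_point mA A0; have [b bP] := density_point mB B0.
have q0 : 0 < 4^-1 :> R by rewrite invr_gt0.
have [ra ra0 {}aP] := aP _ q0; have [rb rb0 {}bP] := bP _ q0.
pose r := Num.min ra rb / 2.
have m0 : 0 < Num.min ra rb by rewrite lt_min ra0.
have r0 : 0 < r by rewrite divr_gt0.
have rra : r < ra by rewrite /r; have : Num.min ra rb <= ra; [rewrite ge_min lexx|lra].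
have rrb : r < rb by rewrite /r; have : Num.min ra rb <= rb; [rewrite ge_min lexx orbT|lra].
have r2 : 0 < r / 2 by rewrite divr_gt0.
have [g gP] := dense (b - a) (r / 2) r2; exists g.
have J0 : (0 < mu (ball a (r / 2) `&` (A `&` [set x | B (x + tau g)%R])))%E.
  apply: (@lebesgue_overlap A B _ (ball a r) (ball b r) _ (4^-1 * r)) => //;
    do ?exact: measurable_ball.
  - by apply: le_ball; lra.
  - move=> x; rewrite /ball/= => xa.
    have -> : b - (x + tau g) = (b - a - tau g) + (a - x) by ring.
    by apply: (le_lt_trans (ler_normD _ _)); lra.
  - by apply: aP; rewrite r0.
  - by apply: bP; rewrite r0.
  - by rewrite lebesgue_measure_ball ?ltW// lte_fin -mulr_natl; lra.
have mBt := measurable_translation (tau g) mB.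
have mAB : measurable (A `&` [set x | B (x + tau g)%R]) by exact: measurableI.
apply: (lebesgue_pos_sub _ mAB _ J0); last exact: subIsetr.
by apply: measurableI => //; exact: measurable_ball.
Qed.

End lebesgue_facts.

(** * Measurability of the level sets of the cocycle *)

Section int_valued_fibers.
Variable R : realType.
Implicit Types f g : R -> int.

Lemma measurable_fiberD f g :
  (forall k, measurable [set x | f x = k]) ->
  (forall k, measurable [set x | g x = k]) ->
  forall k, measurable [set x | f x + g x = k].
Proof.
move=> mf mg k.
rewrite (_ : [set x | _] =
    \bigcup_j ([set x | f x = j] `&` [set x | g x = k - j])); last first.
  apply/seteqP; split=> [x /= <-|x [j _ [/= -> ->]]]; last by rewrite addrC subrK.
  by exists (f x) => //=; split=> //; rewrite addrC addKr.
by apply: countable_bigcupT_measurable => // j; exact: measurableI.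
Qed.

Lemma measurable_step_fun_fiber (s : R) (k : int) :
  measurable [set x | step_fun (x + s) = k].
Proof.
rewrite -[X in measurable X]/[set x | [set y | step_fun y = k] (x + s)].
apply: measurable_translation.
have m1 : measurable [set y : R | step_fun y = 1].
  rewrite (_ : [set y | _] = \bigcup_(p : int) `[p%:~R, p%:~R + 2^-1[%classic); last first.
    apply/seteqP; split=> [y /= y1|y [p _ /=]]; last first.
      rewrite in_itv/= => /andP[y1 y2].
      by rewrite -(subrK p%:~R y) addrC step_fun_pos//; lra.
    exists (Num.floor y) => //=; rewrite in_itv/= floor_le/=.
    move: y1; rewrite /step_fun; case: ifP => //.
    by rewrite /frac_part ltrBlDr addrC.
  exact: countable_bigcupT_measurable.
have [->//|k1] := eqVneq k 1.
have [->|kN1] := eqVneq k (-1).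
  rewrite (_ : [set y | _] = ~` [set y | step_fun y = 1]); first exact: measurableC.
  by apply/seteqP; split=> y /=; have [->|->] := step_fun_pm y.
rewrite (_ : [set y | _] = set0)//; apply/seteqP; split=> y //= yk.
by have [E|E] := step_fun_pm y; move: k1 kN1; rewrite -yk E eqxx.
Qed.

Lemma measurable_cocycle_fiber (alpha s : R) (n k : int) :
  measurable [set x | cocycle alpha n (x + s) = k].
Proof.
have mS m (u : R) l : measurable [set x | birkhoff_sum alpha m (x + u) = l].
  elim: m l => [|m IH] l.
    have [->|l0] := eqVneq l 0.
      by rewrite (_ : [set x | _] = setT)//; apply/seteqP; split=> x //= _; rewrite birkhoff_sum0.
    rewrite (_ : [set x | _] = set0)//; apply/seteqP; split=> x //=.
    by rewrite birkhoff_sum0 => E; rewrite -E eqxx in l0.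
  under eq_set do rewrite birkhoff_sumS -addrA.
  by apply: measurable_fiberD => // j; exact: measurable_step_fun_fiber.
case: n => n; first exact: mS.
have E x : cocycle alpha (Negz n) (x + s) =
    - birkhoff_sum alpha n.+1 (x + (s - n.+1%:R * alpha)).
  by rewrite cocycle_Negz addrA.
under eq_set do rewrite E.
rewrite (_ : [set x | _] =
    [set x | birkhoff_sum alpha n.+1 (x + (s - n.+1%:R * alpha)) = - k]).
  exact: mS.
by apply/seteqP; split=> x /= => [<-|->]; rewrite opprK.
Qed.

End int_valued_fibers.

(** * Recurrence and essential values *)


Definition orbit_shift (R : realType) (alpha : R) (g : int * int) : R :=
  g.1%:~R * alpha + g.2%:~R.

(** Two offsets, instead of 0 and [t], allow the coordinates to be exchanged. The integer [g.2] does
    not enter, by periodicity. *)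
Definition pair_cocycle (R : realType) (alpha s1 s2 : R) (g : int * int) (x : R)
    : int * int :=
  (cocycle alpha g.1 (x + s1), cocycle alpha g.1 (x + s2)).

Definition return_set (R : realType) (alpha s1 s2 : R) (A : set R)
    (g k : int * int) : set R :=
  A `&` [set x | A (x + orbit_shift alpha g)]
    `&` [set x | pair_cocycle alpha s1 s2 g x = k].

(* Essential values over the action of [Z^2] on [R] by the translations
   [x |-> x + n alpha + m], which avoids reductions modulo 1. *)
Definition recurrent (R : realType) (alpha s1 s2 : R) (A : set R)
    (k : int * int) : Prop :=
  exists g, (0 < lebesgue_measure (return_set alpha s1 s2 A g k))%E.

Definition recurrent_value (R : realType) (alpha s1 s2 : R) (k : int * int) : Prop :=
  forall A : set R, measurable A -> (0 < lebesgue_measure A)%E ->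
    recurrent alpha s1 s2 A k.

Section recurrence.
Variables (R : realType) (alpha s1 s2 : R).
Local Notation mu := (@lebesgue_measure R).
Local Notation tau := (orbit_shift alpha).
Local Notation b := (pair_cocycle alpha s1 s2).
Local Notation ret := (return_set alpha s1 s2).
Local Notation rec := (recurrent alpha s1 s2).
Local Notation recv := (recurrent_value alpha s1 s2).
Implicit Types (A B : set R) (g h k l : int * int).

Lemma orbit_shiftD g h : tau (g + h) = tau g + tau h.
Proof. by rewrite /orbit_shift !intrD; ring. Qed.

Lemma pair_cocycleD g h x : b (g + h) x = b g x + b h (x + tau g).
Proof.
rewrite /pair_cocycle /orbit_shift; case: g h => [n m] [n' m'] /=.
have E s : cocycle alpha n' (x + (n%:~R * alpha + m%:~R) + s) =
    cocycle alpha n' (x + s + n%:~R * alpha).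
  by rewrite -[RHS](cocycleDz _ _ _ m); congr cocycle; ring.
by rewrite !E -[(_, _) + (_, _)]/(_ + _, _ + _) -!cocycleD.
Qed.

Lemma measurable_pair_cocycle g k : measurable [set x | b g x = k].
Proof.
rewrite (_ : [set x | _] = [set x | cocycle alpha g.1 (x + s1) = k.1] `&`
    [set x | cocycle alpha g.1 (x + s2) = k.2]).
  by apply: measurableI; exact: measurable_cocycle_fiber.
apply/seteqP; split=> x /=; first by move=> <-.
by move=> [k1 k2]; rewrite /pair_cocycle k1 k2; case: (k).
Qed.

Lemma measurable_return_set A g k : measurable A -> measurable (ret A g k).
Proof.
move=> mA; apply: measurableI; last exact: measurable_pair_cocycle.
by apply: measurableI => //; exact: measurable_translation.
Qed.

Lemma recurrentS A B k : measurable A -> measurable B -> A `<=` B ->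
  rec A k -> rec B k.
Proof.
move=> mA mB AB [g g0]; exists g.
apply: (lebesgue_pos_sub _ _ _ g0); [exact: measurable_return_set..|].
by move=> x [[? ?] ?]; split=> //; split; exact: AB.
Qed.

(** Points that return by [g] with value [k] return again by [h] with value [l]; from [x + tau g]
    the shift [h - g] then leads back to [A] with value [l - k]. *)
Lemma recurrent_valueB k l : recv k -> recv l -> recv (l - k).
Proof.
move=> Hk Hl A mA A0; have [g g0] := Hk A mA A0.
have mB := measurable_return_set g k mA.
have [h h0] := Hl _ mB g0; have mC := measurable_return_set h l mB.
have gN : tau (h - g) = tau h - tau g.
  by apply/eqP; rewrite eq_sym subr_eq -orbit_shiftD subrK.
exists (h - g).
rewrite -(lebesgue_measure_translation (- tau g) mC) in h0.
apply: (lebesgue_pos_sub _ _ _ h0).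
- exact: measurable_translation.
- exact: measurable_return_set.
move=> y /= [[[[Ax Ay] bx] [[Az _] _]] bh]; rewrite /= subrK in Ay.
have E := pair_cocycleD g (h - g) (y - tau g).
rewrite addrC subrK subrK bx bh in E.
split; last first.
  change (b (h - g) y = l - k).
  by rewrite E [RHS]addrC addKr.
by split=> //=; rewrite gN addrA addrAC.
Qed.

Lemma recurrent_value0 : recv 0.
Proof.
move=> A mA A0; exists 0; rewrite (_ : ret A 0 0 = A)//.
apply/seteqP; split=> [x [[]]//|x Ax]; split; last first.
  by rewrite /= /pair_cocycle /= !birkhoff_sum0.
by split=> //=; rewrite /orbit_shift /= mul0r !addr0.
Qed.

Lemma recurrent_valueN k : recv k -> recv (- k).
Proof. by move=> Hk; rewrite -sub0r; apply: recurrent_valueB => //; exact: recurrent_value0. Qed.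

Lemma recurrent_valueD k l : recv k -> recv l -> recv (k + l).
Proof.
move=> Hk Hl; rewrite -[l]opprK; apply: recurrent_valueB => //.
exact: recurrent_valueN.
Qed.

Lemma recurrent_value_mulz k (i : int) : recv k -> recv (k *~ i).
Proof.
move=> Hk; elim/int_ind: i => [|n IH|n IH].
- by rewrite mulr0z; exact: recurrent_value0.
- by rewrite -addn1 PoszD mulrzDr mulr1z; exact: recurrent_valueD.
- rewrite -addn1 PoszD opprD mulrzDr (mulrNz k 1) mulr1z.
  exact: recurrent_valueB.
Qed.

Hypothesis dense : forall x e : R, 0 < e -> exists g, `|x - tau g| < e.

(** The return by [h] is moved along [tau g]. As [b g] equals [l] at both [x] and [x + tau h], the
    cocycle identity leaves the value of [b h] unchanged. *)
Lemma recurrent_conjugate A B g l k : measurable A -> measurable B ->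
  rec (B `&` [set x | A (x + tau g)] `&` [set x | b g x = l]) k -> rec A k.
Proof.
move=> mA mB [h h0]; exists h.
have mB' : measurable (B `&` [set x | A (x + tau g)] `&` [set x | b g x = l]).
  apply: measurableI; last exact: measurable_pair_cocycle.
  by apply: measurableI => //; exact: measurable_translation.
have mC := measurable_return_set h k mB'.
rewrite -(lebesgue_measure_translation (- tau g) mC) in h0.
apply: (lebesgue_pos_sub _ _ _ h0).
- exact: measurable_translation.
- exact: measurable_return_set.
move=> y /= [[[[_ Ay] bg] [[_ Ayh] bgh]] bh]; rewrite /= subrK in Ay.
rewrite /= in Ayh bgh.
split; first by split=> //=; move: Ayh; congr A; ring.
have := pair_cocycleD h g (y - tau g); rewrite addrC pair_cocycleD subrK bg bgh bh.
by rewrite [RHS]addrC => /addrI.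
Qed.

(* A set avoiding one value and a set avoiding another are brought together
   by ergodicity, so one of finitely many alternatives holds uniformly. *)
Lemma recurrent_uniform (u : int * int) (K : seq (int * int)) :
  (forall A, measurable A -> (0 < mu A)%E ->
    exists2 v, v \in K & rec A v /\ rec A (v + u)) ->
  recv u.
Proof.
move=> HK.
have [v [_ Hv]] : exists v, v \in K /\ forall A, measurable A -> (0 < mu A)%E ->
    rec A v /\ rec A (v + u).
  apply: contrapT => N.
  have NK v : v \in K -> exists A, [/\ measurable A, (0 < mu A)%E &
      ~ (rec A v /\ rec A (v + u))].
    move=> vK; apply: contrapT => N1; apply: N; exists v; split=> // A mA A0.
    by apply: contrapT => N2; apply: N1; exists A.
  suff [B [mB B0 BK]] : exists B, [/\ measurable B, (0 < mu B)%E &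
      forall v, v \in K -> ~ (rec B v /\ rec B (v + u))].
    by have [v vK] := HK B mB B0; exact: BK.
  (* Induction on [K] builds one set [B] that fails for every [v] in [K], against [HK]. *)
  elim: K NK {HK N} => [_|v K IH NK].
    exists [set: R]; split=> //.
    apply: (@lt_le_trans _ _ (mu `[0, 1])).
      by rewrite lebesgue_measure_itv/= lte_fin ltr01 sube0 lte_fin ltr01.
    by apply: le_measure; rewrite ?inE.
  have [v' v'K|B [mB B0 BK]] := IH.
    by apply: NK; rewrite in_cons v'K orbT.
  have [A [mA A0 AK]] := NK v (mem_head _ _).
  have [g g0] := dense_translates_meet dense mB mA B0 A0.
  have mBA : measurable (B `&` [set x | A (x + tau g)]).
    by apply: measurableI => //; exact: measurable_translation.
  (* With the value [l] fixed, failure at [v] passes from [A] by [recurrent_conjugate]; the other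
     failures pass from [B] by inclusion. *)
  have [l l0] := lebesgue_pos_fiber mBA (measurable_pair_cocycle g) g0.
  have mC := measurableI _ _ mBA (measurable_pair_cocycle g l).
  exists (B `&` [set x | A (x + tau g)] `&` [set x | b g x = l]); split=> // v'.
  rewrite in_cons => /predU1P[->|v'K] [H1 H2].
    by apply: AK; split; apply: (@recurrent_conjugate A B g l).
  by apply: (BK v' v'K); split; [apply: recurrentS H1|apply: recurrentS H2] => //;
    by move=> x [[]].
have Hv1 : recv v by move=> A mA A0; have [] := Hv A mA A0.
have Hv2 : recv (v + u) by move=> A mA A0; have [] := Hv A mA A0.
have := recurrent_valueB Hv1 Hv2.
by rewrite addrC addKr.
Qed.

End recurrence.

Lemma recurrent_value_swap (R : realType) (alpha s1 s2 : R) (k1 k2 : int) :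
  recurrent_value alpha s1 s2 (k1, k2) -> recurrent_value alpha s2 s1 (k2, k1).
Proof.
move=> H A mA A0; have [g g0] := H A mA A0; exists g.
rewrite (_ : return_set _ _ _ _ _ _ = return_set alpha s1 s2 A g (k1, k2))//.
by apply/seteqP; split=> x [? /= [H1 H2]]; split=> //=;
  rewrite /pair_cocycle H1 H2.
Qed.

(** * Essential values obtained from isolated jumps *)

Section essential_values_of_bad_rotation.
Variables (R : realType) (alpha c : R).
Hypothesis c_gt0 : 0 < c.
Hypothesis alpha_c : forall k p : int, k != 0 ->
  c <= `|k%:~R| * `|k%:~R * alpha - p%:~R|.
Local Notation mu := (@lebesgue_measure R).

Lemma orbit_shift_dense (x e : R) : 0 < e ->
  exists g, `|x - orbit_shift alpha g| < e.
Proof.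
move=> e0; have [i [m H]] := orbit_dense c_gt0 alpha_c x e0.
by exists (i%:Z, m); rewrite /orbit_shift /= opprD addrA.
Qed.

(** The orbit is dense near [(x - alpha) / 2]; doubling the approximation gives odd times. *)
Lemma odd_orbit_shift_dense (x e : R) : 0 < e ->
  exists g : int * int, `|x - orbit_shift alpha (2 * g.1 + 1, g.2)| < e.
Proof.
move=> e0; have e2 : 0 < e / 2 by rewrite divr_gt0.
have [i [m H]] := orbit_dense c_gt0 alpha_c ((x - alpha) / 2) e2.
exists (i%:Z, 2 * m); rewrite /orbit_shift /=.
have -> : x - ((2 * i%:Z + 1)%:~R * alpha + (2 * m)%:~R) =
    2 * ((x - alpha) / 2 - i%:R * alpha - m%:~R).
  by rewrite intrD !intrM -[i%:~R]/(i%:R); field.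
by rewrite normrM ger0_norm// mulrC -ltr_pdivlMr.
Qed.

Section offsets.
Variables s1 s2 : R.
Hypothesis s12 : forall k p : int, 2 * (s1 - s2) != 2 * k%:~R * alpha - p%:~R.

Lemma recurrent_jump : exists M : int, forall A, measurable A -> (0 < mu A)%E ->
  exists v : int * int, [/\ `|v.1| <= M, `|v.2| <= M,
    recurrent alpha s1 s2 A v & recurrent alpha s1 s2 A (v + (2, 0))].
Proof.
have [M [K [r [K0 r0 H]]]] := isolated_jumps c_gt0 alpha_c s12.
exists M => A mA A0; have [x xP] := density_point mA A0.
(* In units of [1 / N]: [K] for the distance from [x] to the jump, [r] for the window, 1 for the
   displacement [q alpha - p]. *)
set L := K + r + 1; have L0 : 0 < L by rewrite !addr_gt0.
(* At radius [L / N] the ball misses at most [e / 4] of [A], so two such losses do not exhaust a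
   window of length [e = r / N]. *)
have [] := xP (r / (4 * L)); first by rewrite divr_gt0// mulr_gt0.
move=> d0 d00 dP.
have [N [q [p [NN qp /(_ x)[D [v1 [v2 [xD [v1M v2M] left right]]]]]]]] :=
  H (Num.bound (L / d0)).+1.
have Nr0 : 0 < N%:R :> R by rewrite ltr0n; clear -NN; lia.
have LN : L / N%:R < d0.
  rewrite ltr_pdivrMr// mulrC -ltr_pdivrMr//.
  apply: (@lt_le_trans _ _ (Num.bound (L / d0))%:R).
    by apply: archi_boundP; rewrite divr_ge0// ltW.
  by rewrite ler_nat; clear -NN; lia.
have LN0 : 0 < L / N%:R by rewrite divr_gt0.
have BA := dP (L / N%:R); rewrite LN0 LN /= in BA; have {}BA := BA isT.
have eE : r / (4 * L) * (L / N%:R) = r / N%:R / 4.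
  by field; rewrite !gt_eqF.
rewrite eE in BA.
have LE : L / N%:R = K / N%:R + r / N%:R + N%:R^-1 by rewrite /L !mulrDl mul1r.
set e := r / N%:R in BA LE left right *.
have e0 : 0 < e by rewrite divr_gt0.
have N0' : 0 < N%:R^-1 :> R by rewrite invr_gt0.
have main (J : set R) v : measurable J -> mu J = e%:E ->
    (forall y, J y -> D - e <= y <= D + e) ->
    (forall y, J y -> pair_cocycle alpha s1 s2 (q%:Z, - p) y = v) ->
    recurrent alpha s1 s2 A v.
  move=> mJ muJ JD Jv; exists (q%:Z, - p).
  have tE : orbit_shift alpha (q%:Z, - p) = q%:R * alpha - p%:~R.
    by rewrite /orbit_shift /= mulrNz.
  move: xD; rewrite ler_norml => /andP[xD1 xD2].
  move: (qp); rewrite ltr_norml => /andP[qp1 qp2].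
  have J0 : (0 < mu (J `&` (A `&` [set y | A (y + orbit_shift alpha (q%:Z, - p))%R])))%E.
    apply: (@lebesgue_overlap R A A J (ball x (L / N%:R)) (ball x (L / N%:R)) _ (e / 4)) => //;
      do ?exact: measurable_ball.
    - move=> y /JD/andP[y1 y2]; rewrite /ball/= ltr_norml LE.
      by apply/andP; split; lra.
    - move=> y /JD/andP[y1 y2]; rewrite /ball/= ltr_norml LE tE.
      by apply/andP; split; lra.
    - by rewrite muJ lte_fin; lra.
  apply: (lebesgue_pos_sub _ _ _ J0).
  - apply: measurableI => //; apply: measurableI => //; exact: measurable_translation.
  - exact: measurable_return_set.
  - by move=> y [Jy [Ay Ayt]]; split=> //; exact: Jv.
exists (v1, v2); split=> //.
- apply: (main `]D - e, D[%classic) => //.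
  + by rewrite lebesgue_measure_itv/= lte_fin ltrBlDr ltrDl e0 -EFinB opprB addrC subrK.
  + by move=> y /=; rewrite in_itv/= => /andP[y1 y2]; apply/andP; split; lra.
  + move=> y /=; rewrite in_itv/= => /left[E1 E2].
    by rewrite /pair_cocycle /= E1 E2.
- apply: (main `[D, D + e[%classic) => //.
  + by rewrite lebesgue_measure_itv/= lte_fin ltrDl e0 -EFinB addrC addKr.
  + by move=> y /=; rewrite in_itv/= => /andP[y1 y2]; apply/andP; split; lra.
  + move=> y /=; rewrite in_itv/= => /right[E1 E2].
    by rewrite /pair_cocycle /= E1 E2 -[(v1, v2) + _]/(v1 + 2, v2 + 0) addr0.
Qed.

Lemma recurrent_value20 : recurrent_value alpha s1 s2 (2, 0).
Proof.
have [M MP] := recurrent_jump.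
(* The integers from [- |M|] to [|M|], so that the candidates for [v] form a finite list that does
   not depend on [A]. *)
pose I := [seq i%:Z - `|M| | i <- iota 0 (2 * `|M|%N).+1].
have II i : `|i| <= M -> i \in I.
  move=> iM; apply/mapP; exists (absz (i + `|M|)); last by lia.
  by rewrite mem_iota; lia.
apply: (@recurrent_uniform _ _ _ _ orbit_shift_dense _ [seq (i, j) | i <- I, j <- I]).
move=> A mA A0; have [[v1 v2] [v1M v2M H1 H2]] := MP A mA A0.
exists (v1, v2); last exact: conj H1 H2.
by apply/allpairsP; exists (v1, v2); split; [exact: II|exact: II|].
Qed.

End offsets.

(** Pairs of even entries are generated by [(2, 0)] and [(0, 2)]. For odd entries, an odd return has
    a value [v] with odd entries, and the even pair [(k1, k2) - v] is then added to it. *)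
Lemma recurrent_value_parity (s1 s2 : R) (k1 k2 j : int) :
  recurrent_value alpha s1 s2 (2, 0) -> recurrent_value alpha s1 s2 (0, 2) ->
  k1 = k2 + 2 * j -> recurrent_value alpha s1 s2 (k1, k2).
Proof.
move=> H1 H2 kj.
have even i1 i2 : recurrent_value alpha s1 s2 (2 * i1, 2 * i2).
  have := recurrent_valueD (recurrent_value_mulz i1 H1) (recurrent_value_mulz i2 H2).
  congr recurrent_value.
  have E (x y i : int) : (x, y) *~ i = (x * i, y * i).
    elim/int_ind: i => [|n IH|n IH]; first by rewrite !mulr0.
      by rewrite -addn1 PoszD mulrzDr mulr1z IH !mulrDr !mulr1.
    by rewrite -addn1 PoszD opprD mulrzDr (mulrNz (x, y) 1) mulr1z IH !mulrDr !mulrN !mulr1.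
  by rewrite !E -[(_, _) + (_, _)]/(_ + _, _ + _) !mul0r addr0 add0r.
have [i [k2E|k2E]] : exists i, k2 = 2 * i \/ k2 = 2 * i + 1.
  by exists (k2 %/ 2)%Z; have := divz_eq k2 2; have := modz_ge0 k2 (isT : 2 != 0 :> int);
    have := ltz_pmod k2 (isT : 0 < 2 :> int); lia.
  by rewrite kj k2E -mulrDr; exact: even.
move=> A mA A0.
have [g g0] := dense_translates_meet odd_orbit_shift_dense mA mA A0 A0.
set h := (2 * g.1 + 1, g.2) in g0.
have mAA : measurable (A `&` [set x | A (x + orbit_shift alpha h)]).
  by apply: measurableI => //; exact: measurable_translation.
have [v v0] := lebesgue_pos_fiber mAA (measurable_pair_cocycle alpha s1 s2 h) g0.
have mB := measurable_return_set alpha s1 s2 h v mA.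
have [x Bx] : exists x, return_set alpha s1 s2 A h v x.
  apply: contrapT => N; move: v0; rewrite (_ : _ `&` _ = set0) ?measure0 ?ltxx//.
  by apply/seteqP; split=> // x Bx; apply: N; exists x.
have [u1 vE1] := cocycle_parity alpha h.1 (x + s1).
have [u2 vE2] := cocycle_parity alpha h.1 (x + s2).
have [[_ _] vE] := Bx; rewrite /= /pair_cocycle vE1 vE2 in vE.
have [w1 [w2 kv]] : exists w1 w2, (k1, k2) - v = (2 * w1, 2 * w2).
  exists (i + j - g.1 - u1), (i - g.1 - u2); rewrite -vE /h /= kj k2E.
  have E2 (a1 a2 b1 b2 : int) : (a1, a2) - (b1, b2) = (a1 - b1, a2 - b2) by [].
  rewrite E2; congr (_, _).
    ring.
  ring.
(* The return set moved to its arrival points lies in [A]; it recurs with the even value along [f],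
   and [h + f] composes the two returns. *)
have mB' := measurable_translation (- orbit_shift alpha h) mB.
have B'0 : (0 < mu [set y | return_set alpha s1 s2 A h v (y - orbit_shift alpha h)%R])%E.
  by rewrite lebesgue_measure_translation.
have [f f0] := even w1 w2 _ mB' B'0; rewrite -kv in f0.
exists (h + f).
have mC := measurable_return_set alpha s1 s2 f ((k1, k2) - v) mB'.
rewrite -(lebesgue_measure_translation (orbit_shift alpha h) mC) in f0.
apply: (lebesgue_pos_sub _ _ _ f0).
- exact: measurable_translation.
- exact: measurable_return_set.
move=> y /= [[[[Ay _] bh] [[_ Af] _]] bf].
rewrite /= addrK in Ay bh; rewrite /= subrK in Af; rewrite /= in bf.
split; last by rewrite /= pair_cocycleD bh bf addrC subrK.
by split=> //=; rewrite orbit_shiftD addrA.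
Qed.

End essential_values_of_bad_rotation.

(** * From translations of the line back to the rotation of the circle *)

Section essential_values_from_recurrence.
Variables (R : realType) (alpha t : R).
Local Notation mu := (@lebesgue_measure R).

Lemma rotation_orbit_shift (n m : int) (x : R) :
  0 <= x + orbit_shift alpha (n, m) < 1 ->
  rotation alpha n x = x + orbit_shift alpha (n, m).
Proof.
move=> xI; rewrite /rotation -(frac_partDz _ m) -addrA -/(orbit_shift alpha (n, m)).
rewrite /frac_part (_ : Num.floor _ = 0) ?subr0//.
by apply: floor_def; rewrite add0r.
Qed.

Lemma rotation_preimage (A : set R) (n : int) : A `<=` `[0, 1[ ->
  rotation alpha n @^-1` A =
    \bigcup_(m : int) [set x | A (x + orbit_shift alpha (n, m))].
Proof.
move=> AI; apply/seteqP; split=> [x /= Ax|x [m _ /= Ax]].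
  exists (- Num.floor (x + n%:~R * alpha)) => //=.
  by move: Ax; rewrite /rotation /frac_part /orbit_shift /= mulrNz addrA.
by rewrite (@rotation_orbit_shift n m)//; have := AI _ Ax; rewrite /= in_itv.
Qed.

(** For [A] in [[0, 1[], a translation by [n alpha + m] that returns to [A] agrees there with the
    [n]-th iterate of the rotation. *)
Lemma recurrent_essential (k : int * int) :
  recurrent_value alpha 0 t k -> essential_value alpha t k.
Proof.
move=> H A mA AI A0; have [[n m] g0] := H A mA A0.
have mR : measurable (return_set alpha 0 t A (n, m) k) by exact: measurable_return_set.
apply: (lebesgue_pos_sub mR _ _ g0).
  apply: countable_bigcupT_measurable => // j.
  apply: measurableI; last exact: measurable_cocycle_fiber.
  apply: measurableI; last first.
    by have := measurable_cocycle_fiber alpha 0 j k.1; under eq_set do rewrite addr0.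
  apply: measurableI => //; rewrite rotation_preimage//.
  by apply: countable_bigcupT_measurable => // i; exact: measurable_translation.
move=> x [[Ax Ay] /= <-]; exists n => //=.
rewrite /pair_cocycle /= addr0; split=> //; split=> //; split=> //=.
by rewrite (@rotation_orbit_shift n m)//; have := AI _ Ay; rewrite /= in_itv.
Qed.

(** Tested on [[0, 1[]. This is how essential values are excluded in both directions of the
    theorem. *)
Lemma essential_value_attained (k : int * int) : essential_value alpha t k ->
  exists n x, cocycle alpha n x = k.1 /\ cocycle alpha n (x + t) = k.2.
Proof.
move=> H; have := H `[0, 1[%classic; rewrite lebesgue_measure_itv/= lte_fin ltr01.
move=> /(_ _ _ _) P; apply: contrapT => N.
have {P} := P (measurable_itv _) (fun x h => h).
rewrite -EFinB subr0 lte_fin ltr01 => /(_ isT).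
rewrite (_ : \bigcup_(n in _) _ = set0) ?measure0 ?ltxx//.
apply/seteqP; split=> // x [n _ [[_ /= H1] H2]]; apply: N; exists n, x.
by split.
Qed.

End essential_values_from_recurrence.

Theorem theorem2 (R : realType) (alpha t : R)
    (halpha : 0 <= alpha < 1) (ht : 0 <= t < 1)
    (hba : badly_approximable alpha) :
  essential_values alpha t = same_parity <->
  (forall k : int, ~ eq_mod1 t (k%:~R * alpha)) /\
  (forall k : int, ~ eq_mod1 t (k%:~R * alpha + 2^-1)).
Proof.
split=> [E|[t1 t2]].
  (* The pair [(0, 4 |k| + 2)] has equal parities, hence is attained under [E], and its second entry
     exceeds [2 |k|]. *)
  have nE (k : int) : ~ forall n x, `|cocycle alpha n (x + t)| <=
      `|cocycle alpha n x| + 2 * `|k|.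
    move=> H; have : same_parity (0, 2 * (2 * `|k| + 1)) by rewrite /same_parity /=; lia.
    rewrite -E => /essential_value_attained[n [x [/= x0 xt]]].
    by have := H n x; rewrite x0 xt; clear; lia.
  split=> k [m tE]; apply: (nE k) => n x.
    have -> : x + t = x + k%:~R * alpha + m%:~R by rewrite -tE; ring.
    rewrite cocycleDz; have := cocycle_shift_le alpha n k x.
    by set u := cocycle _ _ _; set w := cocycle _ _ _; clear; lia.
  have -> : x + t = x + k%:~R * alpha + 2^-1 + m%:~R by rewrite -tE; ring.
  rewrite cocycleDz cocycleDhalf normrN; have := cocycle_shift_le alpha n k x.
  by set u := cocycle _ _ _; set w := cocycle _ _ _; clear; lia.
have [c c0 alpha_c] := badly_approximable_lb halpha hba.
(* The two exclusions combine into one about [2 t]: even [p] contradicts [t1], odd [p] contradicts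
   [t2]. *)
have sep (k p : int) : 2 * t != 2 * k%:~R * alpha + p%:~R.
  apply/eqP => E.
  have [i [pE|pE]] : exists i, p = 2 * i \/ p = 2 * i + 1.
    by exists (p %/ 2)%Z; have := divz_eq p 2; have := modz_ge0 p (isT : 2 != 0 :> int);
      have := ltz_pmod p (isT : 0 < 2 :> int); lia.
    by apply: (t1 k); exists i; rewrite pE intrM in E; lra.
  by apply: (t2 k); exists i; rewrite pE intrD intrM in E; lra.
have H1 : recurrent_value alpha 0 t (2, 0).
  apply: (recurrent_value20 c0 alpha_c) => k p; apply/eqP => E.
  have /eqP := sep (- k) p; apply; rewrite mulrNz; lra.
have H2 : recurrent_value alpha 0 t (0, 2).
  apply: recurrent_value_swap; apply: (recurrent_value20 c0 alpha_c) => k p.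
  by rewrite subr0 -mulrNz; exact: sep.
apply/seteqP; split=> -[k1 k2].
  move=> /essential_value_attained[n [x [/= <- <-]]].
  have [u1 ->] := cocycle_parity alpha n x.
  have [u2 ->] := cocycle_parity alpha n (x + t).
  by rewrite /same_parity /=; clear; lia.
rewrite /same_parity /= => k12; apply: recurrent_essential.
apply: (recurrent_value_parity c0 alpha_c H1 H2 (j := ((k1 - k2) %/ 2)%Z)).
by move: k12; clear; lia.
Qed.
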